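(* Let $\{K^{(n)}_{\cdot}(\cdot,\cdot)\}_{n\in\mathbb{N}^+}$ be a family of CPTNI monotone metrics. Then for every $n\in\mathbb{N}^+$ and every $X\in\mathcal{B}(\mathbb{C}^n)$, the function $\rho\mapsto K^{(n)}_\rho(X,X)$ on $\overline{\mathcal{S}}^{++}(\mathbb{C}^n)$ is monotonically decreasing (that is, $\rho\le\rho'$ implies $K^{(n)}_{\rho'}(X,X)\le K^{(n)}_{\rho}(X,X)$) and convex.
   Context: Notation. $\mathbb{N}^+$ is the set of positive integers and $\mathcal{B}(\mathbb{C}^n)$ is the set of all linear operators on $\mathbb{C}^n$. Set $\overline{\mathcal{S}}^{++}(\mathbb{C}^n)=\{\rho\in\mathcal{B}(\mathbb{C}^n)\mid \operatorname{Tr}\rho\le 1,\ \rho>0\}$ (strictly positive operators of trace at most one) and $\overline{\mathcal{S}}(\mathbb{C}^n)=\{\rho\in\mathcal{B}(\mathbb{C}^n)\mid \operatorname{Tr}\rho\le 1,\ \rho\ge 0\}$. The order $\rho\le\rho'$ means that $\rho'-\rho$ is positive semidefinite. A CPTNI (completely positive, trace non-increasing) map $T:\mathcal{B}(\mathbb{C}^n)\to\mathcal{B}(\mathbb{C}^m)$ is a map of the form $T(X)=\sum_{i=1}^k A_iXA_i^*$ with linear maps $A_1,\dots,A_k:\mathbb{C}^n\to\mathbb{C}^m$ such that $\sum_{i=1}^k A_i^*A_i\le I$. The set of all of them is denoted $\overline{\mathcal{C}}(\mathbb{C}^n,\mathbb{C}^m)$. A family of functions $\{K^{(n)}_{\cdot}(\cdot,\cdot)\}_{n\in\mathbb{N}^+}$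 from $\overline{\mathcal{S}}^{++}(\mathbb{C}^n)\times\mathcal{B}(\mathbb{C}^n)\times\mathcal{B}(\mathbb{C}^n)$ to $\mathbb{C}$ is a family of CPTNI monotone metrics if: (a) for every $n\in\mathbb{N}^+$ and $\rho\in\overline{\mathcal{S}}^{++}(\mathbb{C}^n)$, the map $(X,Y)\mapsto K^{(n)}_\rho(X,Y)$ is a (complex, positive definite) inner product on $\mathcal{B}(\mathbb{C}^n)$, conjugate-linear in the first argument and linear in the second; (b) for every $n,m\in\mathbb{N}^+$, $T\in\overline{\mathcal{C}}(\mathbb{C}^n,\mathbb{C}^m)$, $X\in\mathcal{B}(\mathbb{C}^n)$, $\rho\in\overline{\mathcal{S}}^{++}(\mathbb{C}^n)$, and $\sigma\in\overline{\mathcal{S}}(\mathbb{C}^m)$ such that $T(\rho)+\sigma\in\overline{\mathcal{S}}^{++}(\mathbb{C}^m)$, one has $K^{(m)}_{T(\rho)+\sigma}(T(X),T(X))\le K^{(n)}_\rho(X,X)$. No continuity in $\rho$ is assumed. *)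

(* Defs.v *)
From HB Require Import structures.
From mathcomp Require Import all_boot all_order all_algebra.
From mathcomp Require Import all_classical all_reals.
From mathcomp Require Import convex.
From mathcomp Require Export complex.

Set Implicit Arguments.
Unset Strict Implicit.
Unset Printing Implicit Defensive.

Import Order.TTheory GRing.Theory Num.Theory.

Local Open Scope classical_set_scope.
Local Open Scope ring_scope.
Local Open Scope sesquilinear_scope.

(* Linear maps C^n -> C^m are m x n matrices over R[i], R : realType; the
   adjoint of A is A ^t*. The order of R[i] is partial: x <= y means that
   y - x is real and nonnegative. So 0 <= v^* A v for all v makes A
   self-adjoint, and inequalities between values of K include realness. *)

Section Operators.
Variable R : realType.
Local Notation C := R[i].

Definition posmx n (A : 'M[C]_n) : Prop :=
  forall v : 'cV[C]_n, 0 <= (v ^t* *m A *m v) 0 0.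

Definition posdefmx n (A : 'M[C]_n) : Prop :=
  forall v : 'cV[C]_n, v != 0 -> 0 < (v ^t* *m A *m v) 0 0.

Definition lemx n (A B : 'M[C]_n) : Prop := posmx (B - A).

Definition substates n : set 'M[C]_n :=
  [set rho | \tr rho <= 1 /\ posmx rho].

Definition pos_substates n : set 'M[C]_n :=
  [set rho | \tr rho <= 1 /\ posdefmx rho].

Definition CPTNI n m : set ('M[C]_n -> 'M[C]_m) :=
  [set T | exists (k : nat) (A : 'I_k -> 'M[C]_(m, n)),
      lemx (\sum_(i < k) (A i) ^t* *m A i) 1%:M /\
      forall X, T X = \sum_(i < k) A i *m X *m (A i) ^t*].

Definition inner_product (V : lmodType C) (f : V -> V -> C) : Prop :=
  [/\ forall x, linear_for *%R (f x),
      forall y, linear_for (Num.conj \; *%R) (f^~ y),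
      forall x y, f x y = Num.conj (f y x)
    & forall x, x != 0 -> 0 < f x x].

(* K n rho X Y is only constrained for n > 0 and rho in pos_substates n; its
   values elsewhere are irrelevant. *)
Record CPTNI_monotone_metrics
    (K : forall n, 'M[C]_n -> 'M[C]_n -> 'M[C]_n -> C) : Prop := {
  metric_inner_product : forall (n : nat) (rho : 'M[C]_n),
    (0 < n)%N -> pos_substates rho -> inner_product (K n rho);
  metric_monotone : forall (n m : nat) (T : 'M[C]_n -> 'M[C]_m)
      (X rho : 'M[C]_n) (sigma : 'M[C]_m),
    (0 < n)%N -> (0 < m)%N -> CPTNI T ->
    pos_substates rho -> substates sigma -> pos_substates (T rho + sigma) ->
    K m (T rho + sigma) (T X) (T X) <= K n rho X X
}.

End Operators.

(* Main.v *)
(** Monotonicity is the case of the identity channel with sigma = rho' - rho.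
    For convexity, let (+) denote block sums.  Embedding and compressing blocks
    shows that K_{A (+) B}(X (+) Y) = K_A(X) + K_B(Y), writing K_A(X) for
    K_A(X, X).  Adding the blocks, Z (+) Z' |-> Z + Z', and splitting,
    Z |-> pZ (+) qZ with p + q <= 1, are CPTNI maps, so
      K_{A + B}(X + Y) <= K_A(X) + K_B(Y)   and
      K_{pA}(pX) + K_{qA}(qX) <= K_A(X).
    Hence t |-> K_{tA}(tX) is additive and nonnegative on ]0, 1], thus linear:
    K_{tA}(tX) = t K_A(X).  The first inequality, applied to tA, (1 - t)B, tX
    and (1 - t)X, is then convexity. *)

Require Import Defs.
From mathcomp Require Import all_boot all_order all_algebra.
From mathcomp Require Import all_classical all_reals.
From mathcomp Require Import interval_inference convex ring.

Set Implicit Arguments.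
Unset Strict Implicit.
Unset Printing Implicit Defensive.

Local Open Scope ring_scope.

Import Order.TTheory GRing.Theory Num.Theory.
Local Open Scope sesquilinear_scope.
Local Open Scope complex_scope.

(** Nonnegativity makes [g] monotone, which stands in for continuity: additivity fixes the values at
    fractions [k / N], and fractions just above [t] bound [g t] from above. *)
Lemma additive_unit_linear (R : realType) (g : R -> R) :
    (forall t, 0 < t -> t <= 1 -> 0 <= g t) ->
    (forall s t, 0 < s -> 0 < t -> s + t <= 1 -> g (s + t) = g s + g t) ->
  forall t, 0 < t -> t <= 1 -> g t = t * g 1.
Proof.
move=> g_ge0 gD.
have g_mono s t : 0 < s -> s < t -> t <= 1 -> g s <= g t.
  move=> s0 st t1.
  have -> : g t = g s + g (t - s) by rewrite -gD ?subrKC ?subr_gt0.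
  by rewrite lerDl g_ge0 ?subr_gt0 // (le_trans _ t1) // gerBl ltW.
have gM N k : (0 < k)%N -> (k <= N)%N ->
    g (k%:R / N%:R) = k%:R * g (N%:R^-1).
  elim: k => // -[|k] IH _ kN; first by rewrite !mul1r.
  have N0 : 0 < N%:R :> R by rewrite ltr0n (leq_trans _ kN).
  rewrite -[k.+2%:R in LHS]natr1 mulrDl mul1r gD ?invr_gt0 ?divr_gt0 //.
    by rewrite IH ?(ltnW kN) // -[k.+2%:R]natr1 [RHS]mulrDl mul1r.
  by rewrite -[X in _ + X]mul1r -mulrDl ler_pdivrMr // mul1r natr1 ler_nat.
have g_le t : 0 < t -> t < 1 -> g t <= t * g 1.
  move=> t0 t1; rewrite leNgt; apply/negP; rewrite -subr_gt0.
  set d := g t - _ => d0.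
  (* Suppose [g t] exceeds [t * g 1] by [d > 0]. Take [N] with [N d > g 1] and let [k / N] be the
     least multiple of [1 / N] strictly above [t]; [k <= N] since [t < 1]. Then [g t <= (k / N) g 1
     <= (t + 1 / N) g 1 < t g 1 + d], a contradiction. *)
  set N := (Num.truncn (g 1 / d)).+1.
  have N0 : 0 < N%:R :> R by rewrite ltr0n.
  have g1_ge0 : 0 <= g 1 by apply: g_ge0.
  have gN : g 1 < N%:R * d by rewrite -ltr_pdivrMr // truncnS_gt.
  set k := (Num.truncn (t * N%:R)).+1.
  have tN0 : 0 <= t * N%:R by rewrite mulr_ge0 // ltW.
  have ktN : k.-1%:R <= t * N%:R by rewrite truncn_le.
  have tNk : t * N%:R < k%:R by rewrite truncnS_gt.
  have kN : (k <= N)%N.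
    by rewrite -(ltr_nat R) (le_lt_trans ktN) // gtr_pMl.
  have: g t <= k%:R / N%:R * g 1.
    have <- : g (k%:R / N%:R) = k%:R / N%:R * g 1.
      (* The case [k = N] identifies [g (1 / N)] as [g 1 / N]. *)
      have := @gM N N isT (leqnn N); rewrite divff ?gt_eqF // => ->.
      by rewrite gM // mulrA divfK ?gt_eqF.
    apply: g_mono => //; first by rewrite ltr_pdivlMr.
    by rewrite ler_pdivrMr // mul1r ler_nat.
  apply/negP; rewrite -ltNge -(ltr_pM2r N0).
  rewrite mulrAC divfK ?gt_eqF //.
  have -> : g t = d + t * g 1 by rewrite subrK.
  rewrite mulrDl [d * _]mulrC.
  apply: (@le_lt_trans _ _ ((t * N%:R + 1) * g 1)).
    by rewrite ler_wpM2r // -natr1 lerD2r.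
  by rewrite mulrDl mul1r addrC mulrAC ltrD2r.
move=> t t0; rewrite le_eqVlt => /orP[/eqP->|t1]; first by rewrite mul1r.
apply/eqP; rewrite eq_le g_le //=.
(* The upper bound at [1 - t] is the lower bound at [t], because [g 1 = g t + g (1 - t)]. *)
have := g_le (1 - t); rewrite subr_gt0 gtrBl => /(_ t1 t0).
have -> : g 1 = g t + g (1 - t) by rewrite -gD ?subr_gt0 ?subrKC.
set a := g t; set b := g _.
by rewrite mulrBl mul1r [a + b]addrC -addrA lerDl subr_ge0.
Qed.

(** * Positive matrices, block sums, and channels with few Kraus operators *)

Section PositiveMatrices.
Variable R : realType.
Local Notation C := R[i].

Local Notation form A v := ((v ^t* *m A *m v) 0 0).

Lemma formD n (A B : 'M[C]_n) (v : 'cV[C]_n) :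
  form (A + B) v = form A v + form B v.
Proof. by rewrite mulmxDr mulmxDl mxE. Qed.

Lemma formZ n a (A : 'M[C]_n) (v : 'cV[C]_n) : form (a *: A) v = a * form A v.
Proof. by rewrite -scalemxAr -scalemxAl mxE. Qed.

Lemma adjcol_mx m1 m2 n (A : 'M[C]_(m1, n)) (B : 'M[C]_(m2, n)) :
  (col_mx A B) ^t* = row_mx (A ^t*) (B ^t*).
Proof. by rewrite tr_col_mx map_row_mx. Qed.

Lemma adjrow_mx m n1 n2 (A : 'M[C]_(m, n1)) (B : 'M[C]_(m, n2)) :
  (row_mx A B) ^t* = col_mx (A ^t*) (B ^t*).
Proof. by rewrite tr_row_mx map_col_mx. Qed.

Lemma adj0mx m n : (0 : 'M[C]_(m, n)) ^t* = 0.
Proof. by rewrite trmx0 map_mx0. Qed.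

Lemma adj1mx n : (1%:M : 'M[C]_n) ^t* = 1%:M.
Proof. by rewrite trmx1 map_mx1. Qed.

Lemma form_block n m (A : 'M[C]_n) (B : 'M[C]_m) (u : 'cV_n) (v : 'cV_m) :
  form (block_mx A 0 0 B) (col_mx u v) = form A u + form B v.
Proof.
by rewrite adjcol_mx mul_row_block !mulmx0 addr0 add0r mul_row_col mxE.
Qed.

Lemma posmx0 n : posmx (0 : 'M[C]_n).
Proof. by move=> v; rewrite mulmx0 mul0mx mxE. Qed.

Lemma posmx1 n : posmx (1%:M : 'M[C]_n).
Proof.
move=> v; rewrite mulmx1 mxE sumr_ge0 // => i _.
by rewrite !mxE mulrC mul_conjC_ge0.
Qed.

Lemma posdefmxW n (A : 'M[C]_n) : posdefmx A -> posmx A.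
Proof.
move=> Apd v; have [->|/Apd/ltW//] := eqVneq v 0.
by rewrite mulmx0 mxE.
Qed.

Lemma mxtrace_ge0 n (A : 'M[C]_n) : posmx A -> 0 <= \tr A.
Proof.
move=> Ap; rewrite sumr_ge0 // => i _; have := Ap (delta_mx i 0).
rewrite trmx_delta map_delta_mx -rowE -colE.
by rewrite !mxE.
Qed.

Lemma posmx_block n m (A : 'M[C]_n) (B : 'M[C]_m) :
  posmx A -> posmx B -> posmx (block_mx A 0 0 B).
Proof.
by move=> Ap Bp v; rewrite -[v]vsubmxK form_block addr_ge0.
Qed.

Lemma posdefmx_block n m (A : 'M[C]_n) (B : 'M[C]_m) :
  posdefmx A -> posdefmx B -> posdefmx (block_mx A 0 0 B).
Proof.
move=> Ap Bp v; rewrite -[v]vsubmxK form_block col_mx_eq0 negb_and.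
by case/orP => [/Ap u0|/Bp w0];
  [apply: ltr_pwDl u0 _|apply: ltr_wpDl w0]; apply: posdefmxW.
Qed.

Lemma posdefmxD n (A B : 'M[C]_n) :
  posdefmx A -> posdefmx B -> posdefmx (A + B).
Proof. by move=> Ap Bp v v0; rewrite formD addr_gt0 ?Ap ?Bp. Qed.

Lemma posdefmxZ n a (A : 'M[C]_n) : 0 < a -> posdefmx A -> posdefmx (a *: A).
Proof. by move=> a0 Ap v v0; rewrite formZ mulr_gt0 ?Ap. Qed.

(** Every channel constructed below has one or two Kraus operators. *)
Lemma CPTNI1 n m (A : 'M[C]_(m, n)) :
  lemx (A ^t* *m A) 1%:M -> CPTNI (fun X => A *m X *m A ^t*).
Proof.
by move=> A1; exists 1, (fun=> A); split=> [|X]; rewrite big_ord1.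
Qed.

Lemma CPTNI2 n m (A B : 'M[C]_(m, n)) :
  lemx (A ^t* *m A + B ^t* *m B) 1%:M ->
  CPTNI (fun X => A *m X *m A ^t* + B *m X *m B ^t*).
Proof.
move=> AB1; exists 2, (fun i => if i == 0 then A else B).
by split=> [|X]; rewrite big_ord_recl big_ord1.
Qed.

End PositiveMatrices.

(** * Orthogonality from minimal length *)

Section InnerProduct.
Variables (R : realType) (V : lmodType R[i]) (f : V -> V -> R[i]).
Hypothesis f_inner : inner_product f.

Lemma inner_product0 x : f x 0 = 0.
Proof.
case: f_inner => fr _ _ _; have := fr x 1 0 0.
by rewrite scaler0 add0r mul1r => /esym/eqP; rewrite -subr_eq0 addrK => /eqP.
Qed.

Lemma inner_product_ge0 x : 0 <= f x x.
Proof.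
case: (f_inner) => _ _ _ f_gt0; have [->|/f_gt0/ltW//] := eqVneq x 0.
by rewrite inner_product0.
Qed.

(** A shortest vector [x] of the complex line [x + a *: y] is orthogonal to [y], so the cross terms
    vanish. *)
Lemma inner_product_pythagoras x y :
    (forall a, f x x <= f (x + a *: y) (x + a *: y)) ->
  f (x + y) (x + y) = f x x + f y y.
Proof.
case: (f_inner) => fr _ fC f_gt0 f_min.
have fDr u v w : f u (v + w) = f u v + f u w.
  by rewrite -[v]scale1r fr mul1r scale1r.
have fZr u a v : f u (a *: v) = a * f u v.
  by rewrite -[a *: v]addr0 fr inner_product0 addr0.
have fDl u v w : f (v + w) u = f v u + f w u.
  by rewrite fC fDr rmorphD /= -!fC.
have fZl u a v : f (a *: v) u = a^* * f v u by rewrite fC fZr rmorphM /= -fC.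
suff fxy : f x y = 0.
  by rewrite fDr !fDl fxy (fC y x) fxy rmorph0 addr0 add0r.
have [->|y0] := eqVneq y 0; first exact: inner_product0.
have fy := f_gt0 _ y0.
(* This scalar makes [x + a *: y] orthogonal to [y]; it changes the squared length by
   [- |f x y|^2 / f y y], which minimality forces to be nonnegative. *)
have := f_min (- f y x / f y y).
rewrite fDr !fDl !fZr !fZl -addrA lerDl !rmorphM fmorphV /= rmorphN /= -!fC.
have -> : - f x y / f y y * f y x +
    (- f y x / f y y * f x y + - f y x / f y y * (- f x y / f y y * f y y)) =
    - (`|f x y| ^+ 2 / f y y).
  by rewrite normCK -fC; field; rewrite gt_eqF.
rewrite oppr_ge0 pmulr_lle0 ?invr_gt0 // => fxy.
by apply/eqP; rewrite -normr_eq0 -sqrf_eq0 eq_le fxy exprn_ge0.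
Qed.

End InnerProduct.

(** * Monotone metrics under specific channels *)

Section Metrics.
Variables (R : realType)
  (K : forall n : nat, 'M[R[i]]_n -> 'M[R[i]]_n -> 'M[R[i]]_n -> R[i]).
Arguments K {n}.
Hypothesis HK : CPTNI_monotone_metrics (@K).
Local Notation C := R[i].

(** The images under [T] enter through equations, so that block computations can be discharged apart
    from the arguments of [K]. *)
Lemma metric_le n m (T : 'M[C]_n -> 'M[C]_m) X Y rho rho' sigma :
    (0 < n)%N -> (0 < m)%N -> CPTNI T -> pos_substates rho ->
    pos_substates rho' -> substates sigma ->
    T X = Y -> T rho + sigma = rho' ->
  K rho' Y Y <= K rho X X.
Proof.
move=> n0 m0 CT rhoS rho'S sigS <- rho'E.
by rewrite -rho'E; apply: (metric_monotone HK) => //; rewrite rho'E.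
Qed.

Lemma metric_le0 n m (T : 'M[C]_n -> 'M[C]_m) X Y rho rho' :
    (0 < n)%N -> (0 < m)%N -> CPTNI T -> pos_substates rho ->
    pos_substates rho' -> T X = Y -> T rho = rho' ->
  K rho' Y Y <= K rho X X.
Proof.
move=> n0 m0 CT rhoS rho'S TX Trho.
apply: (metric_le (sigma := 0)) CT _ _ _ TX _ => //.
  by split; [rewrite /= mxtrace0 ler01|exact: posmx0].
by rewrite addr0.
Qed.

Lemma metric_ge0 n (A X : 'M[C]_n) :
  (0 < n)%N -> pos_substates A -> 0 <= K A X X.
Proof.
move=> n0 AS; apply: inner_product_ge0.
exact: metric_inner_product HK _ _ n0 AS.
Qed.

(** * Embedding into a direct sum and compressing to its blocks *)

Section DirectSum.
Variables (n m : nat) (A X : 'M[C]_n) (B Y : 'M[C]_m).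
Hypotheses (n_gt0 : (0 < n)%N) (m_gt0 : (0 < m)%N).
Hypotheses (Apd : posdefmx A) (Bpd : posdefmx B) (trAB : \tr A + \tr B <= 1).

Let nm_gt0 : (0 < n + m)%N. Proof. by rewrite addn_gt0 n_gt0. Qed.

Lemma pos_substates_summandl : pos_substates A.
Proof.
split=> //; apply: le_trans trAB.
by rewrite lerDl mxtrace_ge0 //; apply: posdefmxW.
Qed.

Lemma pos_substates_summandr : pos_substates B.
Proof.
split=> //; apply: le_trans trAB.
by rewrite lerDr mxtrace_ge0 //; apply: posdefmxW.
Qed.

Lemma pos_substates_block : pos_substates (block_mx A 0 0 B).
Proof. by split; [rewrite /= mxtrace_block|exact: posdefmx_block]. Qed.

Let AS := pos_substates_summandl.
Let BS := pos_substates_summandr.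
Let ABS := pos_substates_block.

(** The isometric embedding sends [A] to [A (+) 0], which is not strictly positive. Taking
    [sigma = 0 (+) B] repairs the state without changing the tangent vector [X (+) 0]. *)
Lemma metric_embedl :
  K (block_mx A 0 0 B) (block_mx X 0 0 0) (block_mx X 0 0 0) <= K A X X.
Proof.
pose V : 'M[C]_(n + m, n) := col_mx 1%:M 0.
have VE : V ^t* = row_mx 1%:M 0 by rewrite adjcol_mx adj1mx adj0mx.
have VP Z : V *m Z *m V ^t* = block_mx Z 0 0 0.
  by rewrite VE mul_col_mx mul1mx mul0mx mul_col_row !mulmx1 !mulmx0.
apply: (metric_le (T := fun Z => V *m Z *m V ^t*) (sigma := block_mx 0 0 0 B)).
- exact: n_gt0.
- exact: nm_gt0.
- apply: CPTNI1; rewrite VE mul_row_col mulmx1 mulmx0 addr0 /lemx subrr.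
  exact: posmx0.
- exact: AS.
- exact: ABS.
- split; first by rewrite /= mxtrace_block mxtrace0 add0r; case: BS.
  by apply: posmx_block; [exact: posmx0|exact: posdefmxW].
- exact: VP.
- by rewrite VP add_block_mx !addr0 add0r.
Qed.

Lemma metric_embedr :
  K (block_mx A 0 0 B) (block_mx 0 0 0 Y) (block_mx 0 0 0 Y) <= K B Y Y.
Proof.
pose V : 'M[C]_(n + m, m) := col_mx 0 1%:M.
have VE : V ^t* = row_mx 0 1%:M by rewrite adjcol_mx adj1mx adj0mx.
have VP Z : V *m Z *m V ^t* = block_mx 0 0 0 Z.
  by rewrite VE mul_col_mx mul1mx mul0mx mul_col_row !mulmx1 !mulmx0.
apply: (metric_le (T := fun Z => V *m Z *m V ^t*) (sigma := block_mx A 0 0 0)).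
- exact: m_gt0.
- exact: nm_gt0.
- apply: CPTNI1; rewrite VE mul_row_col mulmx1 mulmx0 add0r /lemx subrr.
  exact: posmx0.
- exact: BS.
- exact: ABS.
- split; first by rewrite /= mxtrace_block mxtrace0 addr0; case: AS.
  by apply: posmx_block; [exact: posdefmxW|exact: posmx0].
- exact: VP.
- by rewrite VP add_block_mx !addr0 add0r.
Qed.

(** [V ^t* *m V] is the projection onto the first block, hence at most the identity. The compression
    discards the second block, so [Y] is arbitrary; this freedom yields orthogonality in
    [metric_block]. *)
Lemma metric_compressl :
  K A X X <= K (block_mx A 0 0 B) (block_mx X 0 0 Y) (block_mx X 0 0 Y).
Proof.
pose V : 'M[C]_(n, n + m) := row_mx 1%:M 0.
have VE : V ^t* = col_mx 1%:M 0 by rewrite adjrow_mx adj1mx adj0mx.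
have VP Z W : V *m block_mx Z 0 0 W *m V ^t* = Z.
  rewrite VE mul_row_block !mul1mx !mul0mx !addr0 mul_row_col.
  by rewrite mulmx1 mulmx0 addr0.
apply: (metric_le0 (T := fun Z => V *m Z *m V ^t*)) => //.
apply: CPTNI1; rewrite VE mul_col_row !mulmx1 !mulmx0 /lemx.
rewrite scalar_mx_block opp_block_mx add_block_mx subrr !subr0.
by apply: posmx_block; [exact: posmx0|exact: posmx1].
Qed.

Lemma metric_compressr :
  K B Y Y <= K (block_mx A 0 0 B) (block_mx X 0 0 Y) (block_mx X 0 0 Y).
Proof.
pose V : 'M[C]_(m, n + m) := row_mx 0 1%:M.
have VE : V ^t* = col_mx 0 1%:M by rewrite adjrow_mx adj1mx adj0mx.
have VP Z W : V *m block_mx Z 0 0 W *m V ^t* = W.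
  rewrite VE mul_row_block !mul1mx !mul0mx !add0r mul_row_col.
  by rewrite mulmx1 mulmx0 add0r.
apply: (metric_le0 (T := fun Z => V *m Z *m V ^t*)) => //.
apply: CPTNI1; rewrite VE mul_col_row !mulmx1 !mulmx0 /lemx.
rewrite scalar_mx_block opp_block_mx add_block_mx !subr0 subrr.
by apply: posmx_block; [exact: posmx1|exact: posmx0].
Qed.

End DirectSum.

(* Cutting off the second block does not increase the length of X (+) zY for
   any scalar z, which forces X (+) 0 and 0 (+) Y to be orthogonal. *)
Lemma metric_block n m (A X : 'M[C]_n) (B Y : 'M[C]_m) :
    (0 < n)%N -> (0 < m)%N -> posdefmx A -> posdefmx B -> \tr A + \tr B <= 1 ->
  K (block_mx A 0 0 B) (block_mx X 0 0 Y) (block_mx X 0 0 Y) =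
  K A X X + K B Y Y.
Proof.
move=> n0 m0 Apd Bpd trAB.
have AB_inner : inner_product (@K (n + m) (block_mx A 0 0 B)).
  apply: (metric_inner_product HK); first by rewrite addn_gt0 n0.
  exact: pos_substates_block.
have XYE a : block_mx X 0 0 0 + a *: block_mx 0 0 0 Y =
    block_mx X 0 0 (a *: Y) :> 'M[C]_(n + m).
  by rewrite scale_block_mx !scaler0 add_block_mx !addr0 add0r.
have XK : K (block_mx A 0 0 B) (block_mx X 0 0 0) (block_mx X 0 0 0) = K A X X.
  by apply: le_anti; rewrite metric_embedl ?metric_compressl.
have YK : K (block_mx A 0 0 B) (block_mx 0 0 0 Y) (block_mx 0 0 0 Y) = K B Y Y.
  by apply: le_anti; rewrite metric_embedr ?metric_compressr.
rewrite -[Y in LHS]scale1r -XYE scale1r.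
rewrite (inner_product_pythagoras AB_inner) ?XK ?YK // => a.
by rewrite XYE metric_compressl.
Qed.

(** Adding the diagonal blocks is a partial trace: its Kraus operators [V] and [W] read off the two
    blocks, and [V ^t* *m V + W ^t* *m W] is exactly the identity. *)
Lemma metric_add_le n (A B X Y : 'M[C]_n) :
    (0 < n)%N -> posdefmx A -> posdefmx B -> \tr A + \tr B <= 1 ->
  K (A + B) (X + Y) (X + Y) <= K A X X + K B Y Y.
Proof.
move=> n0 Apd Bpd trAB; rewrite -metric_block //.
pose V : 'M[C]_(n, n + n) := row_mx 1%:M 0.
pose W : 'M[C]_(n, n + n) := row_mx 0 1%:M.
have VE : V ^t* = col_mx 1%:M 0 by rewrite adjrow_mx adj1mx adj0mx.
have WE : W ^t* = col_mx 0 1%:M by rewrite adjrow_mx adj1mx adj0mx.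
have TE Z Z' : V *m block_mx Z 0 0 Z' *m V ^t* +
    W *m block_mx Z 0 0 Z' *m W ^t* = Z + Z'.
  rewrite VE WE !mul_row_block !mul1mx !mul0mx !addr0 !add0r !mul_row_col.
  by rewrite !mulmx1 !mulmx0 addr0 add0r.
apply: (metric_le0 (T := fun Z => V *m Z *m V ^t* + W *m Z *m W ^t*)) => //.
- by rewrite addn_gt0 n0.
- apply: CPTNI2; rewrite VE WE !mul_col_row !mulmx1 !mulmx0 /lemx.
  rewrite scalar_mx_block add_block_mx !addr0 !add0r subrr; exact: posmx0.
- exact: pos_substates_block.
- by split; [rewrite /= mxtraceD|exact: posdefmxD].
Qed.

(** The Kraus operators are the two block embeddings weighted by square roots, so the trace
    condition reads [p + q <= 1]. Keeping them separate avoids the off-diagonal blocks that the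
    single operator [V + W] would create. *)
Lemma metric_split_le n (A X : 'M[C]_n) p q :
    (0 < n)%N -> pos_substates A -> 0 < p -> 0 < q -> p + q <= 1 ->
  K (p *: A) (p *: X) (p *: X) + K (q *: A) (q *: X) (q *: X) <= K A X X.
Proof.
move=> n0 AS p0 q0 pq1; have [trA Apd] := AS.
have trpq : \tr (p *: A) + \tr (q *: A) <= 1.
  rewrite !mxtraceZ -mulrDl mulr_ile1 ?(ltW (addr_gt0 p0 q0)) //.
  by rewrite mxtrace_ge0 //; apply: posdefmxW.
have pA := posdefmxZ p0 Apd; have qA := posdefmxZ q0 Apd.
rewrite -metric_block //.
pose V : 'M[C]_(n + n, n) := sqrtC p *: col_mx 1%:M 0.
pose W : 'M[C]_(n + n, n) := sqrtC q *: col_mx 0 1%:M.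
(* In [R[i]], [0 < r] makes [r] real, so its square root is real and fixed by conjugation. *)
have adjZ r k l (Z : 'M[C]_(k, l)) : 0 < r ->
    (sqrtC r *: Z) ^t* = sqrtC r *: Z ^t*.
  move=> r0; rewrite linearZ map_mxZ /= conj_Creal // ger0_real //.
  by rewrite sqrtC_ge0 ltW.
have sqrtZ r k l (Z : 'M[C]_(k, l)) : sqrtC r *: (sqrtC r *: Z) = r *: Z.
  by rewrite scalerA -expr2 sqrtCK.
have VE : V ^t* = sqrtC p *: row_mx 1%:M 0.
  by rewrite adjZ // adjcol_mx adj1mx adj0mx.
have WE : W ^t* = sqrtC q *: row_mx 0 1%:M.
  by rewrite adjZ // adjcol_mx adj1mx adj0mx.
have TE Z : V *m Z *m V ^t* + W *m Z *m W ^t* = block_mx (p *: Z) 0 0 (q *: Z).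
  rewrite VE WE /V /W -!scalemxAl -!scalemxAr !sqrtZ.
  rewrite !(mul_col_mx _ _ Z) !mul1mx !mul0mx !mul_col_row !mulmx1 !mulmx0.
  by rewrite !scale_block_mx !scaler0 add_block_mx !addr0 !add0r.
apply: (metric_le0 (T := fun Z => V *m Z *m V ^t* + W *m Z *m W ^t*)) => //.
- by rewrite addn_gt0 n0.
- apply: CPTNI2; rewrite VE WE /V /W -!scalemxAl -!scalemxAr !sqrtZ.
  rewrite !mul_row_col !mulmx1 !mulmx0 addr0 add0r -scalerDl /lemx.
  rewrite -{1}[1%:M]scale1r -scalerBl => v.
  by rewrite formZ mulr_ge0 ?subr_ge0 //; apply: posmx1.
- exact: pos_substates_block.
Qed.

Lemma pos_substatesZ n (A : 'M[C]_n) t :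
  pos_substates A -> 0 < t -> t <= 1 -> pos_substates (t *: A).
Proof.
case=> trA Apd t0 t1; split; last exact: posdefmxZ.
rewrite /= mxtraceZ mulr_ile1 // ?(ltW t0) //.
by rewrite mxtrace_ge0 //; apply: posdefmxW.
Qed.

Lemma metric_scale n (A X : 'M[C]_n) t :
    (0 < n)%N -> pos_substates A -> 0 < t -> t <= 1 ->
  K (t *: A) (t *: X) (t *: X) = t * K A X X.
Proof.
move=> n0 AS t0 t1.
(* The scalar [t] lives in [R[i]] but is real by positivity. The functional equation is solved over
   [R] for the real part [g], which loses nothing since [k] is nonnegative on ]0, 1]. *)
pose k (s : R) := K (s%:C *: A) (s%:C *: X) (s%:C *: X).
pose g s := complex.Re (k s).
have C0 (s : R) : 0 < s -> 0 < s%:C by rewrite ltcR.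
have C1 (s : R) : s <= 1 -> s%:C <= 1 by rewrite -lecR.
have k_ge0 s : 0 < s -> s <= 1 -> 0 <= k s.
  by move=> /C0 s0 /C1 s1; apply: metric_ge0 => //; apply: pos_substatesZ.
have gE s : 0 < s -> s <= 1 -> k s = (g s)%:C.
  by move=> s0 s1; rewrite RRe_real // ger0_real // k_ge0.
have kD s u : 0 < s -> 0 < u -> s + u <= 1 -> k (s + u) = k s + k u.
  move=> s0 u0 su1; apply: le_anti; apply/andP; split.
    rewrite /k rmorphD /= !scalerDl; apply: metric_add_le => //.
    - by apply: posdefmxZ (C0 _ s0) AS.2.
    - by apply: posdefmxZ (C0 _ u0) AS.2.
    rewrite !mxtraceZ -mulrDl -rmorphD mulr_ile1 ?AS.1 ?C1 //.
      by rewrite ltW ?C0 ?addr_gt0.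
    by rewrite mxtrace_ge0 //; apply: posdefmxW AS.2.
  have su0 : 0 < s + u by rewrite addr_gt0.
  (* For the reverse inequality the state to split is [(s + u) A], with weights [s / (s + u)] and
     [u / (s + u)] summing to 1. *)
  have E v : v%:C = (v / (s + u))%:C * (s + u)%:C.
    by rewrite -rmorphM divfK ?gt_eqF.
  rewrite {1 2}/k (E s) (E u) -!scalerA; apply: metric_split_le => //.
  - by apply: pos_substatesZ; rewrite ?C0 ?C1.
  - by rewrite C0 ?divr_gt0.
  - by rewrite C0 ?divr_gt0.
  - by rewrite -rmorphD -mulrDl divff ?gt_eqF.
have g_lin : forall s, 0 < s -> s <= 1 -> g s = s * g 1.
  apply: additive_unit_linear => [s s0 s1|s u s0 u0 su1].
    by rewrite -lecR -gE // k_ge0.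
  by rewrite /g kD // raddfD.
have tE : t = (complex.Re t)%:C by rewrite RRe_real // gtr0_real.
have Rt0 : 0 < complex.Re t by rewrite -ltcR -tE.
have Rt1 : complex.Re t <= 1 by rewrite -lecR -tE.
have := gE _ Rt0 Rt1; rewrite g_lin // rmorphM /= -gE // -tE /k -tE => ->.
by rewrite !scale1r.
Qed.

Lemma metric_mix_le n (A B X : 'M[C]_n) t :
    (0 < n)%N -> pos_substates A -> pos_substates B -> 0 < t -> t < 1 ->
  K (t *: A + (1 - t) *: B) X X <= t * K A X X + (1 - t) * K B X X.
Proof.
move=> n0 AS BS t0 t1; have t'0 : 0 < 1 - t by rewrite subr_gt0.
have t'1 : 1 - t <= 1 by rewrite gerBl ltW.
rewrite -!metric_scale // ?(ltW t1) //.
(* Only the tangent vectors on the left are decomposed; those on the right already carry the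
   weights, by homogeneity. *)
have {1 2}-> : X = t *: X + (1 - t) *: X by rewrite -scalerDl subrKC scale1r.
apply: metric_add_le => //.
- exact: posdefmxZ t0 AS.2.
- exact: posdefmxZ t'0 BS.2.
rewrite !mxtraceZ -[leRHS](subrKC t) lerD // ger_pMr ?AS.1 ?BS.1 //.
Qed.

End Metrics.

Theorem corollary2p5 (R : realType)
    (K : forall n : nat, 'M[R[i]]_n -> 'M[R[i]]_n -> 'M[R[i]]_n -> R[i])
    (HK : CPTNI_monotone_metrics K) (n : nat) (n_gt0 : (0 < n)%N)
    (X : 'M[R[i]]_n) :
  (forall rho rho' : 'M[R[i]]_n,
      pos_substates rho -> pos_substates rho' -> lemx rho rho' ->
      K n rho' X X <= K n rho X X) /\
  convex_function (@pos_substates R n) (fun rho => K n rho X X).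
Proof.
split=> [rho rho' rhoS rho'S le_rho|].
  pose V : 'M[R[i]]_n := 1%:M.
  have VP Z : V *m Z *m V ^t* = Z by rewrite adj1mx mul1mx mulmx1.
  (* The difference [rho' - rho] is positive by hypothesis, and its trace is at most that of [rho']
     because [rho] has nonnegative trace. *)
  apply: (metric_le HK (T := fun Z => V *m Z *m V ^t*)
    (sigma := rho' - rho)) => //.
  - by apply: CPTNI1; rewrite adj1mx mulmx1 /lemx subrr; apply: posmx0.
  - split=> //; rewrite /= linearB /= (le_trans _ rho'S.1) // gerBl.
    by rewrite mxtrace_ge0 //; apply: posdefmxW rhoS.2.
  - by rewrite VP subrKC.
move=> t rho rho'; rewrite !inE => rhoS rho'S.
change (K n (t%:num *: rho + (1 - t%:num) *: rho') X X <=
  t%:num * K n rho X X + (1 - t%:num) * K n rho' X X).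
have : 0 <= t%:num by [].
have : t%:num <= 1 by [].
(* The endpoints are treated apart: at weight 0 a scaled state is no longer strictly positive, so
   homogeneity does not apply. *)
rewrite le_eqVlt => /orP[/eqP-> _|t1].
  by rewrite subrr scale0r mul0r !addr0 scale1r mul1r.
rewrite le_eqVlt => /orP[/eqP<-|t0].
  by rewrite subr0 scale0r mul0r !add0r scale1r mul1r.
exact: metric_mix_le.
Qed.
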